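(* Let $M\ge N\ge K\ge 2$ and let $F:(\mathbb{R}^M,0)\to(\mathbb{R}^N,0)$ and $G:(\mathbb{R}^N,0)\to(\mathbb{R}^K,0)$ be analytic map germs with $F$ tame, $\mathrm{Disc}\,F=\{0\}$ and $\mathrm{Sing}\,G\subseteq V_G$. Let $H=G\circ F$ and suppose that $F(M(H))=M(G)$ as germs of sets at the origin. Then $G$ is tame if and only if $H$ is tame.
   Context: All analytic map germs are non-constant; a germ and its representatives are denoted by the same symbol, and all sets are considered as germs at the origin. For a map germ $F:(\mathbb{R}^M,0)\to(\mathbb{R}^N,0)$, put $V_F=F^{-1}(0)$ and let $\mathrm{Sing}\,F$ be the set of points $x$ where the Jacobian matrix $\mathrm{d}F(x)$ does not have maximal rank (rank less than the target dimension $N$, i.e. $F$ is not a submersion at $x$). $\mathrm{Disc}\,F=F(\mathrm{Sing}\,F)$. The condition $\mathrm{Disc}\,F=\{0\}$ (isolated critical value at the origin) means $\mathrm{Sing}\,F\subseteq V_F$. Let $\rho_E(x)=\|x\|^2$. The Milnor set of $F$ is $M(F)=\mathrm{Sing}(F,\rho_E)$, the set of points where $(F,\rho_E)$ is not a submersion to $\mathbb{R}^{N+1}$; in particular $\mathrm{Sing}\,F\subseteq M(F)$. $F$ is tame if $\overline{M(F)\setminus V_F}\cap V_F\subseteq\{0\}$ as set germs at the origin. The same notation is used for $G$ and $H$. In forming images under $F$, $M(H)$ stands for $M(H)\cap\bar B_\epsilon$, where $\bar B_\epsilon$ is the closed ball of radius $\epsilon$ about the origin of $\mathbb{R}^M$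 and $\epsilon>0$ is arbitrary but small enough. *)

(* Defs.v *)
From HB Require Import structures.
From mathcomp Require Import all_boot all_order all_algebra.
From mathcomp Require Import all_classical all_reals all_analysis.

Set Implicit Arguments.
Unset Strict Implicit.
Unset Printing Implicit Defensive.

Import Order.TTheory GRing.Theory Num.Theory.
Import numFieldNormedType.Exports.

Local Open Scope classical_set_scope.
Local Open Scope ring_scope.

(* A map germ (R^m,0) -> (R^n,0) is given by a total function on 'rV[R]_m;
   every notion below depends only on its values near 0. *)

(* Unconditional summation: [\esum] is meaningful for nonnegative families, so
   the sum is that of the positive parts minus that of the negative parts. *)
Definition has_sum (R : realType) (T : choiceType) (u : T -> R) (s : R) : Prop :=
  summable [set: T] (EFin \o u) /\
  s%:E = (esum [set: T] ((EFin \o u)^\+) - esum [set: T] ((EFin \o u)^\-))%E.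

Definition monomial (R : realType) (m : nat) (k : {ffun 'I_m -> nat})
  (x : 'rV[R]_m) : R := \prod_(i < m) x ord0 i ^+ k i.

Definition analytic_at (R : realType) (m n : nat)
  (F : 'rV[R]_m -> 'rV[R]_n) (a : 'rV[R]_m) : Prop :=
  forall j : 'I_n, exists c : {ffun 'I_m -> nat} -> R,
    \forall x \near a, has_sum (fun k => c k * monomial k (x - a)) (F x ord0 j).

(* Analytic map germs are non-constant by convention. *)
Definition analytic_map_germ (R : realType) (m n : nat)
  (F : 'rV[R]_m -> 'rV[R]_n) : Prop :=
  [/\ F 0 = 0,
      \forall a \near (0 : 'rV[R]_m), analytic_at F a
    & ~ (\forall x \near (0 : 'rV[R]_m), F x = F 0)].

Definition germ_subset (R : realType) (m : nat) (A B : set 'rV[R]_m) : Prop :=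
  \forall x \near (0 : 'rV[R]_m), A x -> B x.

Definition germ_eq (R : realType) (m : nat) (A B : set 'rV[R]_m) : Prop :=
  \forall x \near (0 : 'rV[R]_m), A x <-> B x.

Definition zero_set (R : realType) (m n : nat) (F : 'rV[R]_m -> 'rV[R]_n) :
  set 'rV[R]_m := F @^-1` [set 0].

(* MathComp-Analysis' [jacobian] acts on row vectors, hence is the transpose of
   the usual Jacobian matrix; the rank is the same. *)
Definition Sing (R : realType) (m n : nat) (F : 'rV[R]_m -> 'rV[R]_n) :
  set 'rV[R]_m := [set x | (\rank (jacobian F x) < n)%N].

(* Disc F = {0}, where Disc F = F(Sing F); as usual this also allows F to be a
   submersion at 0, in which case Sing F is the empty germ. *)
Definition isolated_critical_value (R : realType) (m n : nat)
  (F : 'rV[R]_m -> 'rV[R]_n) : Prop := germ_subset (Sing F) (zero_set F).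

(* The library norm on 'rV[R]_m is the sup norm, not the Euclidean one. *)
Definition rho_E (R : realType) (m : nat) (x : 'rV[R]_m) : R :=
  \sum_(i < m) x ord0 i ^+ 2.

Definition euclidean_cball (R : realType) (m : nat) (e : R) : set 'rV[R]_m :=
  [set x | rho_E x <= e ^+ 2].

Definition milnor_set (R : realType) (m n : nat) (F : 'rV[R]_m -> 'rV[R]_n) :
  set 'rV[R]_m :=
  Sing (fun x : 'rV[R]_m => row_mx (F x) (rho_E x)%:M : 'rV[R]_(n + 1)).

Definition tame (R : realType) (m n : nat) (F : 'rV[R]_m -> 'rV[R]_n) : Prop :=
  germ_subset (closure (milnor_set F `\` zero_set F) `&` zero_set F) [set 0].

(* F(A) = B as set germs: A is replaced by A `&` euclidean_cball e with e > 0
   arbitrary but small enough, the image of a set germ not being well defined. *)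
Definition germ_image_eq (R : realType) (m n : nat) (F : 'rV[R]_m -> 'rV[R]_n)
  (A : set 'rV[R]_m) (B : set 'rV[R]_n) : Prop :=
  \forall e \near (0 : R)^'+, germ_eq (F @` (A `&` euclidean_cball e)) B.

(* Main.v *)
Require Import Defs.
From mathcomp Require Import all_boot all_order all_algebra.
From mathcomp Require Import all_classical all_reals all_analysis.
From mathcomp Require Import ring lra.

Set Implicit Arguments.
Unset Strict Implicit.
Unset Printing Implicit Defensive.

Import Order.TTheory GRing.Theory Num.Theory.
Import numFieldNormedType.Exports.

Local Open Scope classical_set_scope.
Local Open Scope ring_scope.

(** Off V_H, the map (H, rho) is (F, rho) followed by G x id, a submersion there
    because Sing G lies in V_G; hence M(H) \ V_H is contained in M(F) \ V_F.
    If G is tame, a point x of V_H that is a limit of points of M(H) \ V_H is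
    sent by F to a limit of points of M(G) \ V_G, so F x = 0, and then x = 0
    because F is tame.  Conversely, a point y of V_G that is a limit of points
    of M(G) \ V_G lifts to such a limit for H, because the points of M(G) near
    0 are images of points of M(H) in a fixed compact ball. *)

(** * Linearity and bounds for unconditional sums of real families *)

Section unconditional_sums.
Variables (R : realType) (T : choiceType).
Implicit Types (u v p q : T -> R) (s t : R).

(** Any splitting into nonnegative families with finite sums computes the sum, not only the one into
    positive and negative parts. Linearity of [has_sum] thus reduces to additivity of [esum] on
    nonnegative families. *)
Lemma has_sum_subr p q P Q : (forall k, 0 <= p k) -> (forall k, 0 <= q k) ->
  esum [set: T] (EFin \o p) = P%:E -> esum [set: T] (EFin \o q) = Q%:E ->
  has_sum (fun k => p k - q k) (P - Q).
Proof.
move=> p0 q0 eP eQ.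
have sp : summable [set: T] (EFin \o p).
  rewrite /summable (eq_esum (b := EFin \o p)) ?eP ?ltry// => k _ /=.
  by rewrite ger0_norm.
have sq : summable [set: T] (EFin \o q).
  rewrite /summable (eq_esum (b := EFin \o q)) ?eQ ?ltry// => k _ /=.
  by rewrite ger0_norm.
split; first exact: (summableB sp sq).
by rewrite EFinB -eP -eQ -(esumB sp sq)//= => k _; rewrite lee_fin.
Qed.

(** Summability makes both extended sums finite, so the defining equation of [has_sum] descends to
    the reals. *)
Lemma has_sum_posneg u s : has_sum u s -> exists P Q,
  [/\ esum [set: T] (EFin \o u)^\+%E = P%:E,
      esum [set: T] (EFin \o u)^\-%E = Q%:E & s = P - Q].
Proof.
move=> [su es].
have fin (f : T -> \bar R) : (forall k, 0 <= f k)%E -> summable [set: T] f ->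
    esum [set: T] f \is a fin_num.
  move=> f0; rewrite summableE (eq_esum (b := f))// => k _.
  by rewrite gee0_abs.
have /fineK eP := fin _ (@funepos_ge0 _ _ (EFin \o u)) (summable_funepos su).
have /fineK eQ := fin _ (@funeneg_ge0 _ _ (EFin \o u)) (summable_funeneg su).
do 2!eexists; split; [exact/esym/eP|exact/esym/eQ|].
by apply: EFin_inj; rewrite es EFinB eP eQ.
Qed.

Lemma has_sumB u v s t : has_sum u s -> has_sum v t ->
  has_sum (fun k => u k - v k) (s - t).
Proof.
move=> /has_sum_posneg[P [Q [eP eQ ->]]] /has_sum_posneg[P' [Q' [eP' eQ' ->]]].
pose pos (w : T -> R) k := Num.max (w k) 0.
pose neg (w : T -> R) k := Num.max (- w k) 0.
have posE w : (EFin \o w)^\+%E = EFin \o pos w.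
  by apply/funext => k; rewrite funeposE /= EFin_max.
have negE w : (EFin \o w)^\-%E = EFin \o neg w.
  by apply/funext => k; rewrite funenegE /= EFin_max.
have pos0 w k : 0 <= pos w k by rewrite le_max lexx orbT.
have neg0 w k : 0 <= neg w k by rewrite le_max lexx orbT.
have pnE w k : w k = pos w k - neg w k.
  rewrite /pos /neg; have [w0|w0] := leP 0 (w k).
    by rewrite max_r ?oppr_le0// subr0.
  by rewrite max_l ?oppr_ge0 ?ltW// sub0r opprK.
(* The positive part of a difference is not the difference of the positive parts, so the terms are
   regrouped as a difference of two nonnegative families. *)
have -> : (fun k => u k - v k) =
    (fun k => (pos u k + neg v k) - (neg u k + pos v k)).
  by apply/funext => k; rewrite {1}(pnE u) {1}(pnE v); ring.
have -> : P - Q - (P' - Q') = (P + Q') - (Q + P') by ring.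
apply: has_sum_subr => [k|k||]; rewrite ?addr_ge0//.
- by rewrite EFinD -eP -eQ' posE negE -esumD// => k _; rewrite lee_fin.
- by rewrite EFinD -eQ -eP' posE negE -esumD// => k _; rewrite lee_fin.
Qed.

Lemma esumZl (D : set T) (x : R) (f : T -> \bar R) : 0 <= x ->
  (forall k, 0 <= f k)%E ->
  (\esum_(k in D) (x%:E * f k) = x%:E * \esum_(k in D) f k)%E.
Proof.
move=> x0 f0; rewrite /esum -ereal_supZl//; last first.
  apply/set0P; exists 0%E, set0; first exact: fsets_set0.
  by rewrite fsbig_set0.
congr ereal_sup; rewrite image_comp; congr image; apply/funext => A /=.
by rewrite ge0_mule_fsumr.
Qed.

Lemma has_sum0 : has_sum (fun _ : T => 0 : R) 0.
Proof.
have e0 : esum [set: T] (EFin \o (fun=> 0 : R)) = 0%:E by rewrite esum1.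
have := has_sum_subr (fun=> lexx 0) (fun=> lexx 0) e0 e0.
by rewrite subrr.
Qed.

Lemma has_sumN u s : has_sum u s -> has_sum (fun k => - u k) (- s).
Proof.
move=> /(has_sumB has_sum0); rewrite sub0r.
by under eq_fun do rewrite sub0r.
Qed.

Lemma has_sumD u v s t : has_sum u s -> has_sum v t ->
  has_sum (fun k => u k + v k) (s + t).
Proof.
move=> us /has_sumN /(has_sumB us); rewrite opprK.
by under eq_fun do rewrite opprK.
Qed.

Lemma has_sum_bigsum (I : Type) (r : seq I) (u : I -> T -> R) (s : I -> R) :
  (forall i, has_sum (u i) (s i)) ->
  has_sum (fun k => \sum_(i <- r) u i k) (\sum_(i <- r) s i).
Proof.
move=> us; elim: r => [|i r IHr].
  by under eq_fun do rewrite big_nil; rewrite big_nil; exact: has_sum0.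
under eq_fun do rewrite big_cons.
by rewrite big_cons; exact: has_sumD.
Qed.

Lemma has_sum_single (k0 : T) (r : R) :
  has_sum (fun k => if k == k0 then r else 0) r.
Proof.
have pos_single (x : R) : 0 <= x -> has_sum (fun k => if k == k0 then x else 0) x.
  move=> x0; have e0 : esum [set: T] (EFin \o (fun=> 0 : R)) = 0%:E.
    by rewrite esum1.
  have ex : esum [set: T] (EFin \o (fun k => if k == k0 then x else 0)) = x%:E.
    rewrite -[RHS](@esum_set1 _ T k0 (fun=> x%:E)) ?lee_fin// [RHS]esum_mkcond.
    by apply: eq_esum => k _ /=; case: eqP => [->|kk0]; [rewrite mem_set|rewrite memNset].
  have := has_sum_subr _ (fun=> lexx 0) ex e0; rewrite subr0.
  by under eq_fun do rewrite subr0; apply => k; case: ifP.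
(* A negative value is handled by negating the sum for [- r]. *)
have [/pos_single//|r0] := leP 0 r.
have /pos_single/has_sumN : 0 <= - r by rewrite oppr_ge0 ltW.
rewrite opprK; congr has_sum; apply/funext => k.
by case: ifP; rewrite ?opprK ?oppr0.
Qed.

(** The sums of the positive and of the negative part both lie in [0, W], so their difference lies
    in [-W, W]. *)
Lemma has_sum_le_norm u s (w : T -> R) W : has_sum u s ->
  (forall k, `|u k| <= w k) -> esum [set: T] (EFin \o w) = W%:E ->
  `|s| <= W.
Proof.
move=> /has_sum_posneg[P [Q [eP eQ ->]]] uw eW.
have w0 k : 0 <= w k by exact: le_trans (uw k).
have P0 : 0 <= P by rewrite -lee_fin -eP esum_ge0.
have Q0 : 0 <= Q by rewrite -lee_fin -eQ esum_ge0.
have PW : P <= W.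
  rewrite -lee_fin -eP -eW le_esum// => k _.
  rewrite funeposE ge_max !lee_fin w0 andbT.
  exact: le_trans (ler_norm _) (uw k).
have QW : Q <= W.
  rewrite -lee_fin -eQ -eW le_esum// => k _.
  rewrite funenegE ge_max !lee_fin w0 andbT.
  by apply: le_trans (uw k); rewrite -normrN ler_norm.
rewrite ler_norml; apply/andP; split.
  by rewrite lerNl opprB (le_trans _ QW)// gerBl.
by rewrite (le_trans _ PW)// gerBl.
Qed.

End unconditional_sums.

(** * Monomials and the second-order remainder of a power series *)

Definition multidegree m (k : {ffun 'I_m -> nat}) : nat := (\sum_(i < m) k i)%N.

Definition unit_exponent m (i : 'I_m) : {ffun 'I_m -> nat} :=
  [ffun j => nat_of_bool (j == i)].

Section monomials.
Variables (R : realType) (m : nat).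
Implicit Types (k : {ffun 'I_m -> nat}) (h : 'rV[R]_m).

Lemma monomial_const k (r : R) : monomial k (const_mx r) = r ^+ multidegree k.
Proof.
rewrite /monomial /multidegree expr_sum.
by apply: eq_bigr => i _; rewrite mxE.
Qed.

Lemma monomial_zero h : monomial [ffun=> 0%N] h = 1.
Proof. by rewrite /monomial big1// => i _; rewrite ffunE expr0. Qed.

Lemma monomial_unit i h : monomial (unit_exponent i) h = h ord0 i.
Proof.
rewrite /monomial (bigD1 i)//= big1 ?mulr1 ?ffunE ?eqxx ?expr1// => j ji.
by rewrite ffunE (negbTE ji) expr0.
Qed.

Lemma ler_coord_norm n (h : 'rV[R]_n) i : `|h ord0 i| <= `|h|.
Proof.
rewrite [leRHS]/Num.norm/= mx_normrE.
by apply: (@le_bigmax _ _ _ _ (fun ij => `|h ij.1 ij.2|) (ord0, i)).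
Qed.

Lemma norm_monomial_le k h : `|monomial k h| <= `|h| ^+ multidegree k.
Proof.
rewrite /monomial normr_prod /multidegree expr_sum.
apply: ler_prod => i _; rewrite normr_ge0/= normrX.
by rewrite lerXn2r ?nnegrE ?ler_coord_norm.
Qed.

Lemma unit_exponent_inj : injective (@unit_exponent m).
Proof.
move=> i j /ffunP /(_ i); rewrite !ffunE eqxx.
by case: eqP.
Qed.

(** The exponents of degree below 2 are 0 and the unit exponents. Truncating a family there leaves
    finitely many one-term families, which [has_sum_single] sums. *)
Lemma affine_partE (u : {ffun 'I_m -> nat} -> R) k :
  (if k == [ffun=> 0%N] then u [ffun=> 0%N] else 0) +
  \sum_(i < m) (if k == unit_exponent i then u (unit_exponent i) else 0) =
  if (multidegree k < 2)%N then u k else 0.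
Proof.
have [->|k0] := eqVneq k [ffun=> 0%N].
  rewrite big1 ?addr0 => [|i _]; last first.
    by case: eqP => // /ffunP /(_ i); rewrite !ffunE eqxx.
  by rewrite /multidegree big1// => i _; rewrite ffunE.
rewrite add0r; case: ltnP => [|k2]; last first.
  rewrite big1// => i _; case: eqP => // ki; move: k2.
  rewrite ki /multidegree (bigD1 i)//= big1 ?ffunE ?eqxx// => j ji.
  by rewrite ffunE (negbTE ji).
rewrite ltnS leq_eqVlt ltnS leqn0 => /orP[/sum_nat_eq1[i [_ ki kj]]|].
  have -> : k = unit_exponent i.
    apply/ffunP => j; rewrite ffunE; case: eqVneq => [->|ji]; first exact: ki.
    exact: kj.
  rewrite (bigD1 i)//= eqxx big1 ?addr0// => j ji.
  by case: eqP => // /unit_exponent_inj ij; rewrite ij eqxx in ji.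
rewrite sum_nat_eq0 => /forallP kz; case/eqP: k0.
by apply/ffunP => i; rewrite ffunE; apply/eqP/(implyP (kz i)).
Qed.

(** The series converges absolutely at the point with all coordinates [r]. For [|h| <= r], each term
    of degree at least 2 is at most [(|h| / r) ^+ 2] times the absolute value of the corresponding
    term there. *)
Lemma power_series_remainder (c : {ffun 'I_m -> nat} -> R) (r : R) : 0 < r ->
  summable [set: {ffun 'I_m -> nat}]
    (EFin \o (fun k => c k * monomial k (const_mx r))) ->
  exists C : R, forall h s, `|h| <= r ->
    has_sum (fun k => c k * monomial k h) s ->
    `|s - (c [ffun=> 0%N] + \sum_(i < m) c (unit_exponent i) * h ord0 i)|
      <= C * `|h| ^+ 2.
Proof.
move=> r0 sr.
pose w k := `|c k * monomial k (const_mx r)|.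
have [W eW] : exists W, esum [set: {ffun 'I_m -> nat}] (EFin \o w) = W%:E.
  exists (fine (esum [set: {ffun 'I_m -> nat}] (EFin \o w))).
  by rewrite fineK//; move: sr; rewrite summableE.
(* [W] is the sum of the absolute values of the terms at [const_mx r]. *)
exists (W / r ^+ 2) => h s hr hs.
pose u k := c k * monomial k h.
have ht : has_sum (fun k => if (multidegree k < 2)%N then u k else 0)
    (c [ffun=> 0%N] + \sum_(i < m) c (unit_exponent i) * h ord0 i).
  under eq_fun do rewrite -affine_partE.
  apply: has_sumD.
    rewrite [X in has_sum _ X](_ : _ = u [ffun=> 0%N]).
      exact: has_sum_single.
    by rewrite /u monomial_zero mulr1.
  apply: has_sum_bigsum => i; rewrite -(monomial_unit i h).
  exact: (has_sum_single _ (u (unit_exponent i))).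
pose q := (`|h| / r) ^+ 2.
have -> : W / r ^+ 2 * `|h| ^+ 2 = q * W.
  by rewrite /q expr_div_n mulrC mulrA -mulrAC.
apply: (has_sum_le_norm (has_sumB hs ht) (w := fun k => q * w k)).
  move=> k; case: ltnP => k2.
    by rewrite subrr normr0 mulr_ge0 ?sqr_ge0 ?normr_ge0.
  rewrite subr0 /w normrM normrM monomial_const mulrCA ler_wpM2l//.
  rewrite (ger0_norm (exprn_ge0 _ (ltW r0))).
  apply: le_trans (norm_monomial_le _ _) _.
  (* Write the degree as 2 + d: two factors [|h|] produce [q], and the other d are bounded by
     [r]. *)
  rewrite -(subnKC k2) !exprD /q expr_div_n mulrA divfK ?expf_neq0 ?gt_eqF//.
  by rewrite ler_wpM2l ?sqr_ge0// lerXn2r ?nnegrE// ltW.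
have q0 : 0 <= q by rewrite sqr_ge0.
rewrite EFinM -eW -esumZl// => k.
by rewrite lee_fin normr_ge0.
Qed.

End monomials.

(** * Differentiability of analytic maps *)

Lemma differentiable_quadratic (R : realType) (V W : normedModType R)
    (g : V -> W) (a : V) (C : R) :
  (\forall x \near a, `|g x| <= C * `|x - a| ^+ 2) -> differentiable g a.
Proof.
move=> gC.
have ga : g a = 0.
  have := nbhs_singleton gC.
  by rewrite subrr normr0 expr0n mulr0 normr_le0 => /eqP.
(* The bound forces [g a = 0] and makes [g] an o(x - a), so its differential is the zero map. *)
have go : g \o shift a = cst (g a) + (\0 : V -> W) +o_ 0 id.
  rewrite addr0; apply/eqaddoP => e e0.
  (* Adding 1 keeps the denominator positive when [C] is 0. *)
  have d0 : 0 < e / (`|C| + 1) by rewrite divr_gt0// ltr_wpDl.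
  have gC' : \forall h \near (0 : V), `|g (h + a)| <= C * `|h| ^+ 2.
    move: gC; rewrite (near_shift 0); apply: filterS => h /=.
    by rewrite subr0 addrK.
  near=> h.
  rewrite [X in `|X|](_ : _ = g (h + a)); last by rewrite !fctE /= ga subr0.
  apply: le_trans (_ : C * `|h| ^+ 2 <= _); first by near: h.
  rewrite expr2 mulrA ler_wpM2r//.
  have hd : `|h| <= e / (`|C| + 1) by near: h; exact: nbhs0_le.
  apply: le_trans (_ : (`|C| + 1) * (e / (`|C| + 1)) <= _).
    apply: le_trans (ler_wpM2r (normr_ge0 h) (ler_norm C)) _.
    by apply: ler_pM => //; rewrite lerDl.
  by rewrite mulrC divfK// gt_eqF// ltr_wpDl.
apply/diff_locallyP.
have c0 : continuous (\0 : {linear V -> W}) by exact: cst_continuous.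
by rewrite (diff_unique c0 go).
Unshelve. all: by end_near. Qed.

Lemma analytic_at_differentiable (R : realType) (m n : nat)
    (F : 'rV[R]_m -> 'rV[R]_n) a :
  analytic_at F a -> differentiable F a.
Proof.
move=> Fa.
suff dF j : differentiable (fun x => F x ord0 j) a.
  have -> : F = \sum_(j < n) (fun x => F x ord0 j *: delta_mx ord0 j).
    by apply/funext => x; rewrite fct_sumE [LHS]row_sum_delta.
  by apply: differentiable_sum => j; exact: differentiableZl.
have [c /nbhs_ballP[e /= e0 ce]] := Fa j.
(* Halving puts the point [const_mx r + a] strictly inside the ball where the expansion holds; the
   expansion there supplies the summability that the remainder bound requires. *)
pose r := e / 2.
have r0 : 0 < r by rewrite divr_gt0.
have re : r < e by rewrite /r; lra.
have norm_ce x : `|x - a| < e -> 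
    has_sum (fun k => c k * monomial k (x - a)) (F x ord0 j).
  by move=> xe; apply: ce; rewrite -ball_normE /= distrC.
have nr : `|const_mx r : 'rV[R]_m| <= r.
  rewrite [leLHS]/Num.norm/= mx_normrE.
  by apply: bigmax_le => [|i _]; rewrite ?mxE ?ger0_norm// ltW.
have [|C HC] := @power_series_remainder R m c r r0.
  have [] := norm_ce (const_mx r + a).
    by rewrite addrK (le_lt_trans nr).
  by rewrite addrK.
(* Coordinate [j] is its affine part [l] plus a remainder of quadratic size. *)
pose l x := c [ffun=> 0%N] + \sum_(i < m) c (unit_exponent i) * (x - a) ord0 i.
rewrite (_ : (fun x => _) = (fun x => F x ord0 j - l x) + l); last first.
  by apply/funext => x; rewrite fctE subrK.
apply: differentiableD.
  apply: (@differentiable_quadratic _ _ _ _ _ C).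
  apply/nbhs_ballP; exists r => //= x; rewrite -ball_normE /= distrC => xr.
  by apply: HC; [exact: ltW|exact/norm_ce/(lt_trans xr)].
apply: differentiableD; first exact: differentiable_cst.
rewrite (_ : (fun x => _) =
    \sum_(i < m) (fun x => c (unit_exponent i) *: (x - a) ord0 i)); last first.
  by apply/funext => x; rewrite fct_sumE.
apply: differentiable_sum => i; apply: differentiableZ.
apply: (@differentiable_comp _ _ _ _ (fun x => x - a) (fun y => y ord0 i)).
  by apply: (differentiableB (f := id)) => //; exact: differentiable_cst.
exact: differentiable_coord.
Qed.

(** * Jacobian calculus and the Milnor set of a composite *)

Section jacobian_calculus.
Variable R : realType.

Lemma mul_row_jacobian m n (f : 'rV[R]_m -> 'rV[R]_n) x v :
  v *m jacobian f x = 'd f x v.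
Proof. exact: mul_rV_lin1. Qed.

Lemma jacobian_comp m n p (f : 'rV[R]_m -> 'rV[R]_n)
    (g : 'rV[R]_n -> 'rV[R]_p) x :
  differentiable f x -> differentiable g (f x) ->
  jacobian (g \o f) x = jacobian f x *m jacobian g (f x).
Proof.
move=> df dg; apply/row_matrixP => i; rewrite !rowE mulmxA !mul_row_jacobian.
by rewrite diff_comp.
Qed.

Lemma jacobianD m n (f g : 'rV[R]_m -> 'rV[R]_n) x :
  differentiable f x -> differentiable g x ->
  jacobian (f + g) x = jacobian f x + jacobian g x.
Proof.
move=> df dg; apply/row_matrixP => i; rewrite !rowE.
rewrite [RHS]mulmxDr [LHS]mul_row_jacobian (diffD df dg) /=.
by congr (_ + _); exact/esym/mul_row_jacobian.
Qed.

Lemma differentiable_mulmxr m n (A : 'M[R]_(m, n)) x :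
  differentiable (fun v : 'rV[R]_m => v *m A) x.
Proof.
rewrite (_ : (fun v => _) = \sum_(i < m) (fun v : 'rV_m => v ord0 i *: row i A)).
  apply: differentiable_sum => i; apply: differentiableZl.
  exact: differentiable_coord.
by apply/funext => v; rewrite fct_sumE mulmx_sum_row.
Qed.

Lemma jacobian_mulmxr m n (A : 'M[R]_(m, n)) x :
  jacobian (fun v : 'rV[R]_m => v *m A) x = A.
Proof.
apply/row_matrixP => i; rewrite !rowE mul_row_jacobian.
rewrite (@diff_lin _ _ _ (mulmxr A))// => y.
exact/differentiable_continuous/differentiable_mulmxr.
Qed.

(** Through [row_fullP], being a submersion becomes the existence of a left inverse of the
    transposed Jacobian. *)
Lemma notin_SingP m n (f : 'rV[R]_m -> 'rV[R]_n) x :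
  ~ Sing f x <-> row_full (jacobian f x).
Proof.
rewrite /Sing /= /row_full eqn_leq rank_leq_col /=.
by rewrite ltnNge; split=> [/negP|nr]; [rewrite negbK|apply/negP; rewrite negbK].
Qed.

Lemma differentiable_rho_E m (x : 'rV[R]_m) : differentiable (@rho_E R m) x.
Proof.
rewrite (_ : @rho_E R m =
    \sum_(i < m) ((fun y : 'rV_m => y ord0 i) ^+ 2 : 'rV_m -> R)).
  apply: differentiable_sum => i; apply: differentiableX.
  exact: differentiable_coord.
by apply/funext => y; rewrite fct_sumE.
Qed.

Lemma differentiable_row_mx_rho_E m n (F : 'rV[R]_m -> 'rV[R]_n) x :
  differentiable F x ->
  differentiable (fun y => row_mx (F y) (rho_E y)%:M : 'rV[R]_(n + 1)) x.
Proof.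
move=> dF.
rewrite (_ : (fun y => _) = (fun y => F y *m row_mx 1%:M 0) +
    (fun y => rho_E y *: row_mx 0 1%:M)).
  apply: differentiableD.
    exact: (differentiable_comp dF (differentiable_mulmxr _ _)).
  exact: differentiableZl (differentiable_rho_E _).
apply/funext => y; rewrite fctE mul_mx_row mulmx1 mulmx0 scale_row_mx scaler0.
by rewrite add_row_mx addr0 add0r scale_scalar_mx mulr1.
Qed.

(* [(G o F, rho) = (G x id) o (F, rho)], and [G x id] is a submersion wherever
   [G] is. *)
Lemma milnor_set_comp m n p (F : 'rV[R]_m -> 'rV[R]_n)
    (G : 'rV[R]_n -> 'rV[R]_p) x :
  differentiable F x -> differentiable G (F x) -> ~ Sing G (F x) ->
  milnor_set (G \o F) x -> milnor_set F x.
Proof.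
move=> dF dG /notin_SingP/row_fullP[L LG]; apply: contraPP => /notin_SingP.
move=> /row_fullP[B BF]; apply/notin_SingP/row_fullP.
pose Phi y : 'rV_(n + 1) := row_mx (F y) (rho_E y)%:M.
pose fstv (z : 'rV[R]_(n + 1)) := z *m col_mx 1%:M 0 : 'rV[R]_n.
(* [Psi] is G x id, written with constant matrices so that the chain and sum rules give its
   Jacobian; [fstv] projects onto the first [n] coordinates. *)
pose Psi : 'rV[R]_(n + 1) -> 'rV[R]_(p + 1) :=
  ((fun z => z *m row_mx 1%:M 0) \o (G \o fstv)) +
  (fun z => z *m (col_mx 0 1%:M *m row_mx 0 1%:M)).
have fstvPhi y : fstv (Phi y) = F y.
  by rewrite /fstv mul_row_col mulmx1 mulmx0 addr0.
have -> : (fun y => row_mx ((G \o F) y) (rho_E y)%:M) = Psi \o Phi.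
  apply/funext => y; rewrite /Psi /= !fctE /= fstvPhi mulmxA mul_row_col.
  rewrite mulmx0 add0r mulmx1 !mul_mx_row !mulmx0 !mulmx1 add_row_mx.
  by rewrite addr0 add0r.
have dPhi : differentiable Phi x by exact: differentiable_row_mx_rho_E.
have dfst : differentiable fstv (Phi x) by exact: differentiable_mulmxr.
have dGfst : differentiable (G \o fstv) (Phi x).
  by apply: (differentiable_comp dfst); rewrite fstvPhi.
have dmul q r (A : 'M[R]_(q, r)) z := differentiable_mulmxr A z.
have dG1 := differentiable_comp dGfst
  (dmul _ _ (row_mx 1%:M 0 : 'M[R]_(p, p + 1)) (G (fstv (Phi x)))).
have dPsi : differentiable Psi (Phi x).
  exact: (differentiableD dG1 (dmul _ _ _ _)).
rewrite (jacobian_comp dPhi dPsi) (jacobianD dG1 (dmul _ _ _ _)).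
rewrite (jacobian_comp dGfst (dmul _ _ _ _)) (jacobian_comp dfst) ?fstvPhi//.
rewrite !jacobian_mulmxr.
rewrite mul_col_mx mul1mx mul0mx !mul_col_row !mulmx0 !mulmx1.
rewrite add_block_mx !addr0 !add0r.
(* [B] cancels the Jacobian of [Phi]; the block matrix then cancels that of [Psi], which is block
   diagonal with blocks the Jacobian of [G] and 1. *)
exists (block_mx L 0 0 1%:M *m B).
rewrite -mulmxA (mulmxA B) BF mul1mx mulmx_block.
by rewrite LG !mulmx0 !mul0mx mulmx1 !addr0 add0r -scalar_mx_block.
Qed.

End jacobian_calculus.

(** * Euclidean balls against the sup norm *)

Lemma rho_E0 (R : realType) m : rho_E (0 : 'rV[R]_m) = 0.
Proof. by rewrite /rho_E big1// => i _; rewrite mxE expr0n. Qed.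

Lemma euclidean_cball_norm (R : realType) m (e : R) (x : 'rV[R]_m) :
  0 <= e -> euclidean_cball e x -> `|x| <= e.
Proof.
move=> e0; rewrite /euclidean_cball /rho_E /= => xe.
rewrite [leLHS]/Num.norm/= mx_normrE; apply: bigmax_le => // -[i j] _ /=.
rewrite -(ler_pXn2r (n := 2))// ?nnegrE// -normrX ger0_norm ?sqr_ge0//.
apply: le_trans xe; rewrite (ord1 i) (bigD1 j)//= lerDl sumr_ge0// => k _.
exact: sqr_ge0.
Qed.

Lemma euclidean_cball_closed (R : realType) m (e : R) :
  closed (@euclidean_cball R m e).
Proof.
have -> : @euclidean_cball R m e = @rho_E R m @^-1` [set r | r <= e ^+ 2] by [].
apply: preimage_closed; last exact: closed_le.
by move=> x _; exact/differentiable_continuous/differentiable_rho_E.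
Qed.

Lemma euclidean_cball_compact (R : realType) m (e : R) : 0 <= e ->
  compact (@euclidean_cball R m e).
Proof.
move=> e0; apply: bounded_closed_compact; last exact: euclidean_cball_closed.
exists e; split; first exact: num_real.
by move=> M eM x /(euclidean_cball_norm e0) /le_trans; apply; exact: ltW.
Qed.

Lemma nbhs_euclidean_cball (R : realType) m (e : R) : 0 < e ->
  nbhs (0 : 'rV[R]_m) (euclidean_cball e).
Proof.
move=> e0.
have rc : {for (0 : 'rV[R]_m), continuous (@rho_E R m)}.
  exact/differentiable_continuous/differentiable_rho_E.
apply: (rc [set r | r <= e ^+ 2]); rewrite rho_E0.
apply: filterS (nbhs0_le (exprn_gt0 2 e0)) => r; exact: le_trans (ler_norm r).
Qed.

(** * Transfer of tameness between G and its composite with F *)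

Section tameness_transfer.
Variables (R : realType) (M N K : nat).
Variables (F : 'rV[R]_M -> 'rV[R]_N) (G : 'rV[R]_N -> 'rV[R]_K).
Hypothesis F0 : F 0 = 0.
Hypothesis dF : \forall x \near (0 : 'rV[R]_M), differentiable F x.

Let cF : {for (0 : 'rV[R]_M), continuous F}.
Proof. exact/differentiable_continuous/(nbhs_singleton dF). Qed.

Let near_comp (P : set 'rV[R]_N) : 
  nbhs (0 : 'rV[R]_N) P -> \forall x \near (0 : 'rV[R]_M), P (F x).
Proof. by move=> P0; apply: cF; rewrite F0. Qed.

Lemma tame_comp (e : R) : 0 < e -> G 0 = 0 ->
  (\forall y \near (0 : 'rV[R]_N), differentiable G y) ->
  germ_subset (Sing G) (zero_set G) ->
  germ_subset (F @` (milnor_set (G \o F) `&` euclidean_cball e)) (milnor_set G) ->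
  tame F -> tame G -> tame (G \o F).
Proof.
move=> e0 G0 dG SG FM tF tG.
(* The local facts are needed at the points [z] approximating [x], not just at [x]. Passing to the
   interior makes [good] a neighbourhood of each [x] near 0. *)
pose good := [set x | [/\ differentiable F x, differentiable G (F x),
  Sing G (F x) -> zero_set G (F x), euclidean_cball e x &
  (F @` (milnor_set (G \o F) `&` euclidean_cball e)) (F x) ->
  milnor_set G (F x)]].
have good0 : nbhs (0 : 'rV[R]_M) good.
  near=> x; split; near: x => //.
  - exact: (near_comp dG).
  - exact: (near_comp SG).
  - exact: nbhs_euclidean_cball.
  - exact: (near_comp FM).
have tGF := near_comp tG; have goodi := nbhs_interior good0.
rewrite /tame /germ_subset in tF *.
move: tF tGF goodi; apply: filterS3 => x tFx tGx goodx.
move=> [clx Hx].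
have dFx : differentiable F x by have [] := nbhs_singleton goodx.
have Fx0 : F x = 0.
  (* By continuity, points [z] of M(H) off V_H close to [x] have images close to [F x]; these images
     lie in M(G) and off V_G, so tameness of [G] applies at [F x]. *)
  apply: tGx; split => // U /(differentiable_continuous dFx) UF.
  have [z [[Mz Hz] [[_ _ _ Bz FMz] Uz]]] := clx _ (filterI goodx UF).
  by exists (F z); split => //; split => //; apply: FMz; exists z.
(* Nearby points [z] of M(H) off V_H lie in M(F), since [G] is a submersion at [F z], and off V_F,
   since [G 0 = 0]. Tameness of [F] then gives [x = 0]. *)
apply: tFx; split => // U xU.
have [z [[Mz Hz] [[dFz dGz SGz _ _] Uz]]] := clx _ (filterI goodx xU).
exists z; split => //; split.
  by apply: milnor_set_comp Mz => // /SGz.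
by move=> Fz; apply: Hz; rewrite /zero_set /= Fz.
Unshelve. all: by end_near. Qed.

Lemma tame_of_comp :
  germ_image_eq F (milnor_set (G \o F)) (milnor_set G) ->
  tame (G \o F) -> tame G.
Proof.
move=> FM tH.
have : nbhs (0 : 'rV[R]_M) [set x | differentiable F x /\
    ((closure (milnor_set (G \o F) `\` zero_set (G \o F)) `&`
      zero_set (G \o F)) x -> x = 0)] by exact: filterI.
move=> /nbhs_ballP[d /= d0 dP].
(* [e < d] places the closed Euclidean ball of radius [e] inside the sup-norm ball where [F] is
   differentiable and the tameness of H holds pointwise. *)
have [e [[e0 ed] FMe]] : exists e : R, (0 < e /\ e < d) /\
    germ_eq (F @` (milnor_set (G \o F) `&` euclidean_cball e)) (milnor_set G).
  have near_ed : \forall e \near (0 : R)^'+, 0 < e /\ e < d.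
    by near=> e; split; near: e; [exact: nbhs_right_gt|exact: nbhs_right_lt].
  exact: filter_ex (filterI near_ed FM).
have inball x : euclidean_cball e x -> differentiable F x /\
    ((closure (milnor_set (G \o F) `\` zero_set (G \o F)) `&`
      zero_set (G \o F)) x -> x = 0).
  move=> /(euclidean_cball_norm (ltW e0)) xe; apply: dP.
  by rewrite -ball_normE /= sub0r normrN (le_lt_trans xe).
have := nbhs_interior FMe; apply: filterS => y goody [cly Gy].
set A := milnor_set (G \o F) `\` zero_set (G \o F).
pose C := closure A `&` @euclidean_cball R M e.
have Ccompact : compact C.
  apply: subclosed_compact (euclidean_cball_compact (ltW e0)) _.
    by apply: closedI; [exact: closed_closure|exact: euclidean_cball_closed].
  by move=> x [].
have FCclosed : closed (F @` C).
  apply: compact_closed; first exact: norm_hausdorff.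
  apply: continuous_compact Ccompact; apply: continuous_in_subspaceT => x.
  by rewrite inE => -[_ /inball[/differentiable_continuous]].
have [x [Ax Bx] Fxy] : (F @` C) y.
  (* Each [z] of M(G) off V_G near [y] is the image of some [x] of M(H) in the ball, and [x] is off
     V_H because [G z] is nonzero. *)
  apply: FCclosed => U yU.
  have [z [[Mz Gz] [/= iffz Uz]]] := cly _ (filterI goody yU).
  have [x [Hx Bx] Fxz] := iffz.2 Mz.
  exists z; split => //; exists x => //; split => //.
  apply: subset_closure; split => // Hx0; apply: Gz.
  by rewrite /zero_set /= -Fxz.
(* Since [G (F x) = G y = 0], the lifted limit [x] lies in V_H; tameness of H forces [x = 0], hence
   [y = F 0 = 0]. *)
have [_ /(_ (conj Ax _)) x0] := inball _ Bx.
by rewrite -Fxy x0 ?F0// /zero_set /= Fxy.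
Unshelve. all: by end_near. Qed.

End tameness_transfer.

Theorem corollary4p15 (R : realType) (M N K : nat)
  (hMN : (N <= M)%N) (hNK : (K <= N)%N) (hK : (2 <= K)%N)
  (F : 'rV[R]_M -> 'rV[R]_N) (G : 'rV[R]_N -> 'rV[R]_K)
  (hF : analytic_map_germ F) (hG : analytic_map_germ G)
  (hFtame : tame F)
  (hFdisc : isolated_critical_value F)
  (hGsing : germ_subset (Sing G) (zero_set G))
  (hMilnor : germ_image_eq F (milnor_set (G \o F)) (milnor_set G)) :
  tame G <-> tame (G \o F).
Proof.
have [F0 aF _] := hF; have [G0 aG _] := hG.
have dF : \forall x \near (0 : 'rV[R]_M), differentiable F x.
  by apply: filterS aF => x; exact: analytic_at_differentiable.
have dG : \forall y \near (0 : 'rV[R]_N), differentiable G y.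
  by apply: filterS aG => y; exact: analytic_at_differentiable.
split; last exact: (tame_of_comp F0 dF hMilnor).
(* The image equality holds for all small positive radii; one of them is fixed to obtain the
   inclusion of F(M(H)) in M(G). *)
have [e [e0 FM]] : exists e : R, 0 < e /\
    germ_eq (F @` (milnor_set (G \o F) `&` euclidean_cball e)) (milnor_set G).
  exact: filter_ex (filterI (nbhs_right_gt 0) hMilnor).
apply: (tame_comp F0 dF e0 G0 dG hGsing _ hFtame).
rewrite /germ_subset /germ_eq in FM *.
by move: FM; apply: filterS => y [].
Qed.
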